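(* The stationary distribution for the stochastic sandpile model (SSM) does not depend on $\mu$. That is, with $N$ and the toppling laws $(\lambda_v)_{v\in[N]}$ fixed, for any two probability distributions $\mu$ and $\mu'$ on $[N]$, the stationary distribution of the SSM in which sand grains are added according to $\mu$ is the same as the stationary distribution of the SSM in which sand grains are added according to $\mu'$.
   Context: Let $N$ be a nonnegative integer and $[N]=\{1,\ldots,N\}$ the set of sites. A sandpile configuration is a vector $\eta=(\eta_k)_{k\in[N]}$ of positive integers, where $\eta_k$ is the number of sand grains on site $k$. For $v\in[N]$, let $$\mathcal{S}_v=\{\nu\in\mathbb{Z}^{[N]} : \nu_v<0,\ \nu_w\ge 0 \text{ for } w\ne v,\ \sum_{i=1}^N\nu_i\le 0\}$$ be the set of possible topplings of $v$; performing the toppling $\nu$ replaces $\eta$ by $\eta+\nu$. For each $v$, $\lambda_v$ is a probability distribution with finite support on $\mathcal{S}_v$, and the threshold of $v$ is $M_v=\max\{-\nu_v : \nu\in\mathcal{S}_v,\ \lambda_v(\nu)\neq 0\}$. In a configuration $\eta$, site $v$ is stable if $\eta_v\le M_v$ and unstable otherwise; $\eta$ is stable if all its sites are stable. The set of stable configurations is $St=[M_1]\times\cdots\times[M_N]$, where $[M]=\{1,\ldots,M\}$. For $v\in[N]$, $\delta^v$ denotes the vector with a $1$ in position $v$ and $0$ elsewhere. Standing assumption: for every nonempty subset $H\subseteq[N]$ there exists $\ell\in H$ such that $\lambda_\ell(\{\nu\in\mathcal{S}_\ell : \sum_{k\in H}\nu_k<0\})>0$. Random stabilization: given a configuration $\eta$,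 the random stable configuration $\mathcal{RS}(\eta)$ is obtained as follows: while the current configuration $\eta$ is not stable, pick an arbitrary unstable site $v$, draw $D_v\in\mathcal{S}_v$ with law $\lambda_v$ independently from the past, and replace $\eta$ by $\eta+D_v$; when the configuration is stable, return it. Under the standing assumption this terminates almost surely and the law of $\mathcal{RS}(\eta)$ does not depend on which unstable site is picked at each step. Given a probability distribution $\mu$ on $[N]$, the stochastic sandpile model (SSM) is the Markov chain on $St$ in which, at each time step, a sand grain is added at a random site drawn according to $\mu$ and random stabilization is then performed; its transition probabilities are $$P_{\eta,\eta'}=\sum_{k=1}^N\mu(k)\,\mathbb{P}(\mathcal{RS}(\eta+\delta^k)=\eta'),\qquad \eta,\eta'\in St.$$ A stationary distribution is a probability (row) vector $\pi$ on $St$ with $\pi P=\pi$.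
   Formalization: If μ misses some sites, the stationary distribution need not be unique; the formal theorem gives one π stationary for the SSM of every μ, and claims its uniqueness only when μ charges every site (so unique stationary distributions for μ and μ' coincide). *)

(* Defs.v *)
From HB Require Import structures.
From mathcomp Require Import all_boot all_order all_algebra.
From mathcomp Require Import finmap.
From mathcomp Require Import reals topology normedtype sequences.
Set Implicit Arguments.
Unset Strict Implicit.
Unset Printing Implicit Defensive.
Import Order.TTheory GRing.Theory Num.Theory numFieldNormedType.Exports.
Local Open Scope ring_scope.

(* The N sites are the elements of 'I_N. *)

(* Integer vectors indexed by the sites. They serve both as topplings and as
   configurations: a configuration is a vector all of whose entries are
   positive, and a legal toppling of an unstable site preserves positivity. *)
Definition zvec (N : nat) := {ffun 'I_N -> int}.

Definition grain (N : nat) (k : 'I_N) : zvec N := [ffun w => (w == k)%:R].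

Definition is_toppling (N : nat) (v : 'I_N) (nu : zvec N) : bool :=
  [&& nu v < 0, [forall w, (w != v) ==> (0 <= nu w)] & \sum_i nu i <= 0].

Definition is_distr (R : realType) (T : finType) (p : T -> R) : Prop :=
  (forall x, 0 <= p x) /\ \sum_x p x = 1.

(* A finitely supported real function on Z^N for each site. *)
Definition laws (R : realType) (N : nat) := 'I_N -> {fsfun zvec N -> R with 0}.

Definition toppling_laws (R : realType) (N : nat) (lam : laws R N) : Prop :=
  forall v,
    [/\ forall nu, 0 <= lam v nu,
        \sum_(nu <- finsupp (lam v)) lam v nu = 1
      & forall nu, nu \in finsupp (lam v) -> is_toppling v nu].

Definition dissipative (R : realType) (N : nat) (lam : laws R N) : Prop :=
  forall H : {set 'I_N}, H != finset.set0 ->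
    exists2 l, l \in H &
      0 < \sum_(nu <- finsupp (lam l) | \sum_(k in H) nu k < 0) lam l nu.

(* Topplings are negative at v, so `|nu v| is - nu v on the support of lam v. *)
Definition threshold (R : realType) (N : nat) (lam : laws R N) (v : 'I_N) : nat :=
  \max_(nu <- finsupp (lam v)) `|nu v|%N.

Definition stable_at (R : realType) (N : nat) (lam : laws R N)
    (eta : zvec N) (v : 'I_N) : bool := eta v <= (threshold lam v)%:Z.

Definition stable (R : realType) (N : nat) (lam : laws R N) (eta : zvec N) : bool :=
  [forall v, stable_at lam eta v].

(* The choice of the site to topple may depend on the current configuration
   (last argument) and on all the previous ones since the beginning of the
   stabilization (first argument, oldest first). *)
Definition policy (N : nat) := seq (zvec N) -> zvec N -> 'I_N.

Definition legal (R : realType) (N : nat) (lam : laws R N) (pick : policy N) : Prop :=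
  forall past eta, ~~ stable lam eta -> ~~ stable_at lam eta (pick past eta).

(* Probability that the random stabilization started at eta (after the history
   past) stops after at most n topplings, in the configuration eta'. *)
Fixpoint rs_within (R : realType) (N : nat) (lam : laws R N) (pick : policy N)
    (n : nat) (past : seq (zvec N)) (eta eta' : zvec N) : R :=
  if stable lam eta then (eta == eta')%:R
  else if n is n'.+1 then
    \sum_(nu <- finsupp (lam (pick past eta)))
      lam (pick past eta) nu *
      rs_within lam pick n' (rcons past eta) (eta + nu) eta'
  else 0.

(* The probability that RS(eta) = eta': the events above increase with n, and
   their union is the event that the stabilization stops in eta'. *)
Definition rs_prob (R : realType) (N : nat) (lam : laws R N) (pick : policy N)
    (eta eta' : zvec N) : R :=
  limn (fun n => rs_within lam pick n [::] eta eta').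

(* St = [M_1] x ... x [M_N]; the ordinal i encodes i + 1 grains. *)
Definition St (R : realType) (N : nat) (lam : laws R N) : finType :=
  {dffun forall v : 'I_N, 'I_(threshold lam v)}.

Definition conf (R : realType) (N : nat) (lam : laws R N) (s : St lam) : zvec N :=
  [ffun v => (nat_of_ord (s v)).+1%:Z].

Definition ssm (R : realType) (N : nat) (lam : laws R N) (pick : policy N)
    (mu : 'I_N -> R) (s s' : St lam) : R :=
  \sum_k mu k * rs_prob lam pick (conf s + grain k) (conf s').

Definition stationary (R : realType) (N : nat) (lam : laws R N) (pick : policy N)
    (mu : 'I_N -> R) (pi : {ffun St lam -> R}) : Prop :=
  is_distr pi /\ forall s', \sum_s pi s * ssm pick mu s s' = pi s'.

(* Main.v *)
Require Import Defs.
From HB Require Import structures.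
From mathcomp Require Import all_boot all_order all_algebra.
From mathcomp Require Import finmap.
From mathcomp Require Import reals topology normedtype sequences.
From mathcomp Require Import lra.
Set Implicit Arguments.
Unset Strict Implicit.
Unset Printing Implicit Defensive.
Import Order.TTheory GRing.Theory Num.Theory numFieldNormedType.Exports.
Local Open Scope classical_set_scope.
Local Open Scope ring_scope.

(** Write K_k for the Markov kernel on stable configurations that adds a grain
at k and stabilizes, so that the chain with grain distribution mu has kernel
the mu-average of the K_k.

The kernels K_k commute.  Hence if p is invariant for the average of the K_k
under some everywhere positive mu, then so is p K_k for each k.  That averaged
chain has only one invariant distribution, because the full configuration can
be reached from every state by adding grains one at a time without any
toppling.  So p K_k = p for all k, and p is invariant for every other average
as well ([invariant_commuting]).

Commutation, and the independence from the toppling policy, both come from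
bounded functions G on configurations that are harmonic: G eta is the mean of G after
a random toppling of v, for every site v unstable in eta.  Along any legal
policy, G evaluated at the current configuration is then a bounded martingale.
Stabilization terminates almost surely ([running_cvg0]), so optional stopping
says that G eta is the mean of G over the stabilization of eta
([harmonic_stab_law]).  Everything is obtained by choosing G:
- a harmonic function with boundary values the indicator of one stable
  configuration is the law of the stabilization for every policy;
- G = 1 shows that the kernels are stochastic;
- the law of the stabilization of eta plus a grain at l, as a function of eta,
  shows that K_k K_l is the law of stabilizing with both grains added at once,
  which is symmetric in k and l ([grain_kernel_comp]).

What has to be constructed is a harmonic function with prescribed boundary
values, that is, one relation for all unstable sites simultaneously.  This is
the abelian property.  It is proved first for stabilizations in which each site
may topple only a bounded number of times, where induction on the total
number of allowed topplings applies ([cappedE]), and the bounds are then sent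
to infinity ([stab_law_harmonic]).

Termination is by a linear Lyapunov function: weights a_k >= 0 are found such
that the mean of sum_k a_k eta_k drops by at least 1 at every toppling
([exists_weights]), which bounds the expected number of topplings. *)

(** * Invariant distributions of finite Markov chains *)

Definition stochastic (R : realType) (T : finType) (P : T -> T -> R) : Prop :=
  forall s, is_distr (P s).

Definition invariant_measure (R : realType) (T : finType) (P : T -> T -> R) (v : T -> R) : Prop :=
  forall s', \sum_s v s * P s s' = v s'.

Lemma sum_enum_val (R : realType) (T : finType) (F : T -> R) :
  \sum_s F s = \sum_(i < #|T|) F (enum_val i).
Proof. exact: reindex (onW_bij _ (@enum_val_bij T)). Qed.

(** The constant vector 1 is in the right kernel of P - 1, so P - 1 is singular
and has a nonzero left kernel as well. *)
Lemma invariant_neq0_exists (R : realType) (T : finType) (P : T -> T -> R) (r : T) :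
  stochastic P -> exists2 v : T -> R, invariant_measure P v & exists s, v s != 0.
Proof.
move=> Pst.
pose A := \matrix_(i < #|T|, j < #|T|) P (enum_val i) (enum_val j) - 1%:M.
have A1 : A *m const_mx 1 = 0 :> 'cV_#|T|.
  rewrite mulmxBl mul1mx; apply/matrixP => i j; rewrite !mxE.
  under eq_bigr do rewrite !mxE mulr1.
  rewrite -(sum_enum_val (P (enum_val i))).
  by case: (Pst (enum_val i)) => _ ->; rewrite subrr.
have : kermx A != 0.
  rewrite kermx_eq0 row_free_unit; apply/negP => Au.
  have /matrixP/(_ (enum_rank r) 0) : const_mx 1 = 0 :> 'cV[R]_#|T|.
    by rewrite -(mulKmx Au (const_mx 1)) A1 mulmx0.
  by rewrite !mxE => /eqP; rewrite oner_eq0.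
case/rowV0Pn => u /sub_kermxP; rewrite mulmxBr mulmx1 => /eqP.
rewrite subr_eq0 => /eqP uP u0.
exists (fun s => u 0 (enum_rank s)).
  move=> s'; move/matrixP: uP => /(_ 0 (enum_rank s')); rewrite mxE => <-.
  rewrite sum_enum_val; apply: eq_bigr => i _.
  by rewrite !mxE enum_rankK enum_valK.
have /rV0Pn[i ui] := u0.
by exists (enum_val i); rewrite enum_valK.
Qed.

Lemma sum_step (R : realType) (T : finType) (P : T -> T -> R) (v : T -> R) :
  stochastic P -> \sum_s' \sum_s v s * P s s' = \sum_s v s.
Proof.
move=> Pst; rewrite exchange_big; apply: eq_bigr => s _.
by rewrite -mulr_sumr; case: (Pst s) => _ ->; rewrite mulr1.
Qed.

(** The triangle inequality gives |v| <= |v| P entrywise, and both sides have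
the same total mass because P is stochastic. *)
Lemma invariant_norm (R : realType) (T : finType) (P : T -> T -> R) (v : T -> R) :
  stochastic P -> invariant_measure P v -> invariant_measure P (fun s => `|v s|).
Proof.
move=> Pst vP s'; apply/eqP; rewrite -subr_eq0; apply/eqP.
have ge0 s : 0 <= \sum_s0 `|v s0| * P s0 s - `|v s|.
  rewrite subr_ge0 -{1}vP; apply: le_trans (ler_norm_sum _ _ _) _.
  by apply: ler_sum => t _; rewrite normrM (ger0_norm ((Pst t).1 s)).
apply: (@psumr_eq0P _ _ xpredT (fun s => \sum_s0 `|v s0| * P s0 s - `|v s|)) => //.
by rewrite sumrB sum_step // subrr.
Qed.

Lemma invariant_distr_exists (R : realType) (T : finType) (P : T -> T -> R) (r : T) :
  stochastic P -> exists2 p : T -> R, is_distr p & invariant_measure P p.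
Proof.
move=> Pst; have [v vP [s vs]] := invariant_neq0_exists r Pst.
have aP := invariant_norm Pst vP.
have Z0 : 0 < \sum_s `|v s|.
  rewrite lt_def sumr_ge0 ?andbT //; apply/eqP => /psumr_eq0P -/(_ (fun _ _ => normr_ge0 _)).
  by move=> /(_ s isT)/eqP; rewrite normr_eq0 (negPf vs).
exists (fun s => `|v s| / \sum_s `|v s|).
  split=> [t|]; first by rewrite divr_ge0 // ltW.
  by rewrite -mulr_suml divff ?gt_eqF.
move=> s'; rewrite -[in RHS]aP mulr_suml; apply: eq_bigr => t _.
by rewrite mulrAC.
Qed.

(** From every state the chain has a path of positive probability to r; d is
a height that decreases along some possible step. *)
Definition attracts (R : realType) (T : finType) (P : T -> T -> R) (d : T -> nat) (r : T) :=
  forall s, s != r -> exists2 s', 0 < P s s' & (d s' < d s)%N.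

(** If |v| vanishes at a state then it vanishes at all states with a possible
step to it, because |v| is a nonnegative invariant vector. *)
Lemma invariant_eq0 (R : realType) (T : finType) (P : T -> T -> R) (d : T -> nat)
    (r : T) (v : T -> R) :
  stochastic P -> attracts P d r -> invariant_measure P v -> v r = 0 -> forall s, v s = 0.
Proof.
move=> Pst Pr /(invariant_norm Pst) aP vr s.
elim: {s}_.+1 {-2}s (ltnSn (d s)) => // n IH s dn.
have [->//|/Pr [s' Ps' ds']] := eqVneq s r.
have {IH} := IH s' (leq_trans ds' dn); move: (aP s') => /[swap] ->; rewrite normr0.
move=> /psumr_eq0P-/(_ (fun t _ => mulr_ge0 (normr_ge0 _) ((Pst t).1 s')))/(_ s isT)/eqP.
by rewrite mulf_eq0 (gt_eqF Ps') orbF normr_eq0 => /eqP.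
Qed.

(** The combination of p and q that vanishes at r vanishes everywhere, so p
and q are proportional. *)
Lemma invariant_distr_unique (R : realType) (T : finType) (P : T -> T -> R) (d : T -> nat)
    (r : T) (p q : T -> R) :
  stochastic P -> attracts P d r -> is_distr p -> invariant_measure P p ->
  is_distr q -> invariant_measure P q -> p =1 q.
Proof.
move=> Pst Pr [p0 p1] pP [q0 q1] qP.
have vP : invariant_measure P (fun s => q r * p s - p r * q s).
  move=> s'; under eq_bigr do rewrite mulrBl -!mulrA.
  by rewrite sumrB -!mulr_sumr pP qP.
have v0 := invariant_eq0 Pst Pr vP.
have pq : q r = p r.
  have : \sum_s (q r * p s - p r * q s) = 0.
    by apply: big1 => s _; apply: v0; rewrite mulrC subrr.
  rewrite sumrB -!mulr_sumr p1 q1 !mulr1 => /eqP; rewrite subr_eq0 => /eqP //.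
have pr0 : p r != 0.
  apply/eqP => pr; have := p1; rewrite big1 => [/esym/eqP|s _]; first by rewrite oner_eq0.
  exact: invariant_eq0 Pst Pr pP pr s.
move=> s; have /(_ s)/eqP := v0 (etrans (congr1 (fun x => x - _) (mulrC _ _)) (subrr _)).
by rewrite pq -mulrBr mulf_eq0 (negPf pr0) subr_eq0 => /eqP.
Qed.

(** p Q is again a P-invariant distribution, hence equal to p by uniqueness. *)
Lemma invariant_commuting (R : realType) (T : finType) (P Q : T -> T -> R) (d : T -> nat)
    (r : T) (p : T -> R) :
  stochastic P -> attracts P d r -> stochastic Q ->
  (forall s s', \sum_t P s t * Q t s' = \sum_t Q s t * P t s') ->
  is_distr p -> invariant_measure P p -> invariant_measure Q p.
Proof.
move=> Pst Pr Qst PQ pd pP.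
apply: (invariant_distr_unique Pst Pr _ _ pd pP).
  split=> [s|]; last by rewrite sum_step // pd.2.
  by apply: sumr_ge0 => t _; rewrite mulr_ge0 ?pd.1 ?(Qst t).1.
move=> s'; under eq_bigr do rewrite mulr_suml.
rewrite exchange_big /=.
under eq_bigr => s _. under eq_bigr do rewrite -mulrA. rewrite -mulr_sumr -PQ mulr_sumr.
over.
rewrite exchange_big /=; apply: eq_bigr => t _.
by rewrite -[in RHS]pP mulr_suml; apply: eq_bigr => s _; rewrite mulrA.
Qed.

(** * Random topplings *)

Definition topple (R : realType) (N : nat) (lam : laws R N) (v : 'I_N)
    (G : zvec N -> R) (eta : zvec N) : R :=
  \sum_(nu <- finsupp (lam v)) lam v nu * G (eta + nu).

Lemma topple_le (R : realType) (N : nat) (lam : laws R N) (v : 'I_N)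
    (G G' : zvec N -> R) (eta : zvec N) :
  toppling_laws lam ->
  (forall nu, nu \in finsupp (lam v) -> G (eta + nu) <= G' (eta + nu)) ->
  topple lam v G eta <= topple lam v G' eta.
Proof.
move=> lamP GG'; rewrite /topple !big_seq; apply: ler_sum => nu nuv.
by rewrite ler_wpM2l ?GG' //; case: (lamP v).
Qed.

Lemma topple_eq (R : realType) (N : nat) (lam : laws R N) (v : 'I_N)
    (G G' : zvec N -> R) (eta : zvec N) :
  (forall nu, nu \in finsupp (lam v) -> G (eta + nu) = G' (eta + nu)) ->
  topple lam v G eta = topple lam v G' eta.
Proof.
by move=> GG'; rewrite /topple !big_seq; apply: eq_bigr => nu /GG' ->.
Qed.

Lemma topple_cst (R : realType) (N : nat) (lam : laws R N) (v : 'I_N) (x : R)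
    (eta : zvec N) :
  toppling_laws lam -> topple lam v (fun _ => x) eta = x.
Proof.
by move=> lamP; rewrite /topple -mulr_suml; case: (lamP v) => _ -> _; rewrite mul1r.
Qed.

Lemma toppleB (R : realType) (N : nat) (lam : laws R N) (v : 'I_N)
    (G G' : zvec N -> R) (eta : zvec N) :
  topple lam v (fun e => G e - G' e) eta = topple lam v G eta - topple lam v G' eta.
Proof. by rewrite /topple -sumrB; apply: eq_bigr => nu _; rewrite mulrBr. Qed.

Lemma topple_sum (R : realType) (N : nat) (lam : laws R N) (v : 'I_N) (T : finType)
    (G : T -> zvec N -> R) (a : T -> R) (eta : zvec N) :
  topple lam v (fun e => \sum_t G t e * a t) eta = \sum_t topple lam v (G t) eta * a t.
Proof.
rewrite /topple; under eq_bigr do rewrite mulr_sumr.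
rewrite exchange_big /=; apply: eq_bigr => t _; rewrite mulr_suml.
by apply: eq_bigr => nu _; rewrite mulrA.
Qed.

(** Topplings add up, so the order of two independent ones does not matter. *)
Lemma toppleC (R : realType) (N : nat) (lam : laws R N) (v w : 'I_N)
    (G : zvec N -> R) (eta : zvec N) :
  topple lam v (topple lam w G) eta = topple lam w (topple lam v G) eta.
Proof.
rewrite /topple; under eq_bigr do rewrite mulr_sumr.
rewrite exchange_big /=; apply: eq_bigr => nu _; rewrite mulr_sumr.
by apply: eq_bigr => nu' _; rewrite mulrCA addrAC.
Qed.

(** The sites outside H do not lose grains and the total does not increase. *)
Lemma toppling_sum_le0 (N : nat) (v : 'I_N) (nu : zvec N) (H : {set 'I_N}) :
  is_toppling v nu -> v \in H -> \sum_(k in H) nu k <= 0.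
Proof.
move=> /and3P[_ /forallP nu0 tot] vH; apply: le_trans tot.
rewrite [leRHS](bigID (mem H)) /= lerDl; apply: sumr_ge0 => k kH.
by apply: (implyP (nu0 k)); apply: contraNneq kH => ->.
Qed.

Lemma unstable_topple (R : realType) (N : nat) (lam : laws R N) (v w : 'I_N)
    (eta nu : zvec N) :
  toppling_laws lam -> nu \in finsupp (lam v) -> w != v ->
  ~~ stable_at lam eta w -> ~~ stable_at lam (eta + nu) w.
Proof.
move=> lamP nuv wv; rewrite /stable_at ffunE.
case: (lamP v) => _ _ /(_ _ nuv)/and3P[_ /forallP/(_ w)/implyP/(_ wv) nuw _].
by rewrite -!ltNge => /lt_le_trans; apply; rewrite lerDl.
Qed.

Lemma stableP (R : realType) (N : nat) (lam : laws R N) (eta : zvec N) :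
  reflect (forall v, stable_at lam eta v) (stable lam eta).
Proof. exact: forallP. Qed.

Definition populated (N : nat) (eta : zvec N) : Prop := forall k, 0 < eta k.

(** An unstable site has more grains than any of its topplings removes. *)
Lemma populated_topple (R : realType) (N : nat) (lam : laws R N) (v : 'I_N)
    (eta nu : zvec N) :
  toppling_laws lam -> nu \in finsupp (lam v) -> ~~ stable_at lam eta v ->
  populated eta -> populated (eta + nu).
Proof.
move=> lamP nuv ev epos k; rewrite ffunE.
case: (lamP v) => _ _ /(_ _ nuv)/and3P[_ /forallP/(_ k)/implyP nuk _].
move: nuk; have [->|] := eqVneq k v; last first.
  by move=> _ /(_ isT) nuk0; rewrite ltr_wpDr.
have nuM : (`|nu v| <= threshold lam v)%N by exact: leq_bigmax_seq.
move=> _; rewrite -ltrBlDr sub0r; move: ev; rewrite -ltNge; apply: le_lt_trans.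
by rewrite (le_trans (ler_norm _)) // normrN -abszE lez_nat.
Qed.

(** The relation is required at every unstable site of eta, not only at the
one that a given policy would topple. *)
Definition topple_harmonic (R : realType) (N : nat) (lam : laws R N) (G : zvec N -> R) : Prop :=
  forall eta v, ~~ stable_at lam eta v -> G eta = topple lam v G eta.

(** * The abelian property with boundedly many topplings per site *)

Definition spend (N : nat) (c : {ffun 'I_N -> nat}) (v : 'I_N) : {ffun 'I_N -> nat} :=
  [ffun w => (c w - (w == v))%N].

Definition active (R : realType) (N : nat) (lam : laws R N) (c : {ffun 'I_N -> nat})
    (eta : zvec N) (v : 'I_N) : bool := ~~ stable_at lam eta v && (0 < c v)%N.

(** m is fuel for the recursion: when it is the total capacity, it does not run
out before the capacities do. *)
Fixpoint capped_rec (R : realType) (N : nat) (lam : laws R N) (eta' : zvec N) (m : nat)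
    (c : {ffun 'I_N -> nat}) (eta : zvec N) : R :=
  if [pick v | active lam c eta v] is Some v then
    if m is m'.+1 then topple lam v (capped_rec lam eta' m' (spend c v)) eta else 0
  else (stable lam eta && (eta == eta'))%:R.

(** Probability that the stabilization of eta ends in the stable configuration
eta', when each site v can be toppled at most c v times and the process is
stopped when no unstable site can be toppled any more. *)
Definition capped (R : realType) (N : nat) (lam : laws R N) (eta' : zvec N)
    (c : {ffun 'I_N -> nat}) (eta : zvec N) : R :=
  capped_rec lam eta' (\sum_v c v) c eta.

Lemma sum_spend (N : nat) (c : {ffun 'I_N -> nat}) (v : 'I_N) :
  (0 < c v)%N -> (\sum_w c w = (\sum_w spend c v w).+1)%N.
Proof.
move=> cv; rewrite (bigD1 v) //= [in RHS](bigD1 v) //= ffunE eqxx.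
rewrite -addSn subn1 prednK //; congr addn.
by apply: eq_bigr => w /negPf wv; rewrite ffunE wv subn0.
Qed.

Lemma spendC (N : nat) (c : {ffun 'I_N -> nat}) (v w : 'I_N) :
  spend (spend c v) w = spend (spend c w) v.
Proof. by apply/ffunP => k; rewrite !ffunE subnAC. Qed.

Lemma active_topple (R : realType) (N : nat) (lam : laws R N) (c : {ffun 'I_N -> nat})
    (eta nu : zvec N) (v w : 'I_N) :
  toppling_laws lam -> nu \in finsupp (lam v) -> w != v ->
  active lam c eta w -> active lam (spend c v) (eta + nu) w.
Proof.
move=> lamP nuv wv /andP[ew cw]; rewrite /active (unstable_topple lamP nuv) //=.
by rewrite ffunE (negPf wv) subn0.
Qed.

(** The abelian property: toppling any unstable site v with remaining capacity
instead of the selected site w gives the same probability.  If v differs from w,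
then w stays unstable after toppling v and conversely, so by induction on the total capacity
both choices amount to toppling v and w, in either order. *)
Lemma cappedE (R : realType) (N : nat) (lam : laws R N) (eta' : zvec N)
    (c : {ffun 'I_N -> nat}) (eta : zvec N) (v : 'I_N) :
  toppling_laws lam -> active lam c eta v ->
  capped lam eta' c eta = topple lam v (capped lam eta' (spend c v)) eta.
Proof.
move=> lamP; have [m] := ubnP (\sum_w c w).
elim: m c eta v => // m IH c eta v cm av.
rewrite {1}/capped; have /sum_spend cE : (0 < c v)%N by case/andP: av.
rewrite cE /=; case: pickP => [w aw|/(_ v)]; last by rewrite av.
have cw : (0 < c w)%N by case/andP: aw.
have -> : (\sum_k spend c v k = \sum_k spend c w k)%N.
  by apply/eqP; rewrite -eqSS -cE -sum_spend.
rewrite -/(capped _ _ _) in IH *.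
have [->|vw] := eqVneq v w; first by [].
have sm u : (0 < c u)%N -> (\sum_k spend c u k < m)%N.
  by move=> /sum_spend cu; move: cm; rewrite cu.
have H u u' : u != u' -> active lam c eta u -> active lam c eta u' ->
    topple lam u' (capped lam eta' (spend c u')) eta =
    topple lam u' (topple lam u (capped lam eta' (spend (spend c u') u))) eta.
  move=> uu' au au'; apply: topple_eq => nu nuu'.
  apply: IH; last exact: active_topple au.
  by apply: sm; case/andP: au'.
rewrite -[LHS]/(topple lam w (capped lam eta' (spend c w)) eta).
by rewrite (H v w) // (H w v) 1?eq_sym // spendC toppleC.
Qed.

Lemma capped_inactive (R : realType) (N : nat) (lam : laws R N) (eta' : zvec N)
    (c : {ffun 'I_N -> nat}) (eta : zvec N) :
  (forall v, ~~ active lam c eta v) ->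
  capped lam eta' c eta = (stable lam eta && (eta == eta'))%:R.
Proof.
move=> Nact; rewrite /capped; case: (\sum_v c v)%N => [|m] /=;
  by case: pickP => // v; rewrite (negPf (Nact v)).
Qed.

Lemma capped_stable (R : realType) (N : nat) (lam : laws R N) (eta' : zvec N)
    (c : {ffun 'I_N -> nat}) (eta : zvec N) :
  stable lam eta -> capped lam eta' c eta = (eta == eta')%:R.
Proof.
move=> st; rewrite capped_inactive ?st // => v.
by rewrite /active (stableP _ _ st).
Qed.

(** Induction on the total capacity, following the topplings. *)
Lemma capped_ind (R : realType) (N : nat) (lam : laws R N)
    (Q : {ffun 'I_N -> nat} -> zvec N -> Prop) :
  (forall c eta, (forall v, ~~ active lam c eta v) -> Q c eta) ->
  (forall c eta v, active lam c eta v ->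
     (forall eta1, Q (spend c v) eta1) -> Q c eta) ->
  forall c eta, Q c eta.
Proof.
move=> Q0 QS c; have [m] := ubnP (\sum_w c w).
elim: m c => // m IH c cm eta.
case: (pickP (active lam c eta)) => [v av|Nact]; last first.
  by apply: Q0 => v; rewrite Nact.
apply: (QS _ _ v av) => eta1; apply: IH.
by case/andP: av => _ /sum_spend cv; move: cm; rewrite cv.
Qed.

Lemma capped_bound (R : realType) (N : nat) (lam : laws R N) (eta' : zvec N)
    (c : {ffun 'I_N -> nat}) (eta : zvec N) :
  toppling_laws lam -> 0 <= capped lam eta' c eta <= 1.
Proof.
move=> lamP; elim/(@capped_ind _ _ lam): c / eta => c eta; last move=> v av IH.
  by move=> /capped_inactive ->; rewrite ler0n lern1 leq_b1.
rewrite (cappedE _ lamP av); apply/andP; split.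
  rewrite -(topple_cst v 0 eta lamP); apply: topple_le => // nu _.
  by case/andP: (IH (eta + nu)).
rewrite -[leRHS](topple_cst v 1 eta lamP); apply: topple_le => // nu _.
by case/andP: (IH (eta + nu)).
Qed.

(** Larger capacities only add successful stabilizations. *)
Lemma capped_le (R : realType) (N : nat) (lam : laws R N) (eta' : zvec N)
    (c c' : {ffun 'I_N -> nat}) (eta : zvec N) :
  toppling_laws lam -> (forall v, c v <= c' v)%N ->
  capped lam eta' c eta <= capped lam eta' c' eta.
Proof.
move=> lamP; elim/(@capped_ind _ _ lam): c / eta c' => c eta.
  move=> Nact c' cc'; rewrite capped_inactive //.
  have [st|_] := boolP (stable lam eta); first by rewrite capped_stable.
  by case/andP: (capped_bound eta' c' eta lamP).
move=> v av IH c' cc'; rewrite (cappedE _ lamP av).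
have av' : active lam c' eta v.
  by case/andP: av => ev cv; rewrite /active ev (leq_trans cv).
rewrite (cappedE _ lamP av'); apply: topple_le => // nu _.
by apply: IH => w; rewrite !ffunE leq_sub2r.
Qed.

(** * The law of the stabilization *)

Definition stab_law (R : realType) (N : nat) (lam : laws R N) (eta' eta : zvec N) : R :=
  limn (fun n => capped lam eta' [ffun=> n] eta).

Lemma stab_law_cvg (R : realType) (N : nat) (lam : laws R N) (eta' eta : zvec N) :
  toppling_laws lam ->
  capped lam eta' [ffun=> n] eta @[n --> \oo] --> stab_law lam eta' eta.
Proof.
move=> lamP; apply: nondecreasing_is_cvgn.
  by move=> m n mn; apply: capped_le => // v; rewrite !ffunE.
by exists 1 => _ [n _ <-]; case/andP: (capped_bound eta' [ffun=> n] eta lamP).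
Qed.

Lemma topple_cvg (R : realType) (N : nat) (lam : laws R N) (v : 'I_N)
    (G_ : nat -> zvec N -> R) (G : zvec N -> R) (eta : zvec N) :
  (forall e, G_ n e @[n --> \oo] --> G e) ->
  topple lam v (G_ n) eta @[n --> \oo] --> topple lam v G eta.
Proof.
move=> GG; apply: cvg_big => [|nu _]; first exact: add_continuous.
by apply: cvgM => //; exact: cvg_cst.
Qed.

(** With uniform capacity n.+1, toppling v leaves capacities between n and
n.+1, so by monotonicity the value at capacity n.+1 lies between the means
after toppling v of the values at capacities n and n.+1. *)
Lemma stab_law_harmonic (R : realType) (N : nat) (lam : laws R N) (eta' : zvec N) :
  toppling_laws lam -> topple_harmonic lam (stab_law lam eta').
Proof.
move=> lamP eta v ev.
have act n : active lam [ffun=> n.+1] eta v by rewrite /active ev ffunE.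
have Lcvg := fun e => stab_law_cvg (eta' := eta') (eta := e) lamP.
have Tcvg : topple lam v (capped lam eta' [ffun=> n]) eta @[n --> \oo]
    --> topple lam v (stab_law lam eta') eta by exact: topple_cvg.
have LcvgS : capped lam eta' [ffun=> n.+1] eta @[n --> \oo] --> stab_law lam eta' eta.
  by rewrite (cvg_shiftS (fun n => capped lam eta' [ffun=> n] eta)).
have TcvgS : topple lam v (capped lam eta' [ffun=> n.+1]) eta @[n --> \oo]
    --> topple lam v (stab_law lam eta') eta.
  by rewrite (cvg_shiftS (fun n => topple lam v (capped lam eta' [ffun=> n]) eta)).
apply/eqP; rewrite eq_le; apply/andP; split.
  apply: (ler_cvg_to LcvgS TcvgS); apply: nearW => n.
  rewrite (cappedE _ lamP (act n)); apply: topple_le => // nu _.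
  by apply: capped_le => // w; rewrite !ffunE leq_subr.
apply: (ler_cvg_to Tcvg LcvgS); apply: nearW => n.
rewrite (cappedE _ lamP (act n)); apply: topple_le => // nu _.
by apply: capped_le => // w; rewrite !ffunE; case: eqP => _; rewrite ?subn0 ?subn1.
Qed.

Lemma stab_law_bound (R : realType) (N : nat) (lam : laws R N) (eta' eta : zvec N) :
  toppling_laws lam -> 0 <= stab_law lam eta' eta <= 1.
Proof.
move=> lamP; have cv := stab_law_cvg (eta' := eta') (eta := eta) lamP.
apply/andP; split; [apply: (cvgr_to_ge cv)|apply: (cvgr_to_le cv)];
  by apply: nearW => n; case/andP: (capped_bound eta' [ffun=> n] eta lamP).
Qed.

Lemma stab_law_stable (R : realType) (N : nat) (lam : laws R N) (eta' eta : zvec N) :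
  stable lam eta -> stab_law lam eta' eta = (eta == eta')%:R.
Proof.
move=> st; apply: lim_near_cst => //; apply: nearW => n; exact: capped_stable.
Qed.

(** * Termination of the stabilization *)

Definition mean_toppling (R : realType) (N : nat) (lam : laws R N) (v k : 'I_N) : R :=
  \sum_(nu <- finsupp (lam v)) lam v nu * (nu k)%:~R.

Lemma sum_mean_toppling (R : realType) (N : nat) (lam : laws R N) (v : 'I_N) (a : 'I_N -> R) :
  \sum_k a k * mean_toppling lam v k =
  \sum_(nu <- finsupp (lam v)) lam v nu * \sum_k a k * (nu k)%:~R.
Proof.
under eq_bigr do rewrite mulr_sumr.
rewrite exchange_big /=; apply: eq_bigr => nu _; rewrite mulr_sumr.
by apply: eq_bigr => k _; rewrite mulrCA.
Qed.

Lemma sum_in_mean_toppling (R : realType) (N : nat) (lam : laws R N) (v : 'I_N)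
    (H : {set 'I_N}) :
  \sum_(k in H) mean_toppling lam v k =
  \sum_(nu <- finsupp (lam v)) lam v nu * (\sum_(k in H) nu k)%:~R.
Proof.
rewrite exchange_big /=; apply: eq_bigr => nu _.
by rewrite rmorph_sum mulr_sumr.
Qed.

Lemma mean_toppling_le0 (R : realType) (N : nat) (lam : laws R N) (v : 'I_N)
    (H : {set 'I_N}) :
  toppling_laws lam -> v \in H -> \sum_(k in H) mean_toppling lam v k <= 0.
Proof.
move=> lamP vH; rewrite sum_in_mean_toppling big_seq; apply: sumr_le0 => nu nuv.
case: (lamP v) => lam0 _ /(_ _ nuv)/toppling_sum_le0/(_ vH) nuH.
by rewrite mulr_ge0_le0 // lerz0.
Qed.

Lemma mean_toppling_lt0 (R : realType) (N : nat) (lam : laws R N) (v : 'I_N)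
    (H : {set 'I_N}) :
  toppling_laws lam -> v \in H ->
  0 < \sum_(nu <- finsupp (lam v) | \sum_(k in H) nu k < 0) lam v nu ->
  \sum_(k in H) mean_toppling lam v k < 0.
Proof.
move=> lamP vH; rewrite -oppr_lt0; apply: le_lt_trans.
rewrite sum_in_mean_toppling -sumrN [leRHS]big_mkcond !big_seq /=.
apply: ler_sum => nu nuv; case: (lamP v) => lam0 _ /(_ _ nuv)/toppling_sum_le0/(_ vH) nuH.
case: ltP => [nuH0|_]; last by rewrite mulr_ge0_le0 // lerz0.
rewrite -mulrN1 ler_wpM2l // -(rmorphN1 intr) ler_int.
by rewrite -ltzD1 addNr.
Qed.

(** Induction on the set H of sites where the mean decrease is required.
Dissipativity gives l in H whose topplings strictly decrease the mean number of
grains in H.  Adding a large multiple B of the indicator of H to the weights for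
H minus l settles l, and does no harm at the other sites of H, whose topplings
never increase the number of grains in H. *)
Lemma exists_weights (R : realType) (N : nat) (lam : laws R N) :
  toppling_laws lam -> dissipative lam ->
  exists2 a : 'I_N -> R, forall k, 0 <= a k &
    forall v, \sum_k a k * mean_toppling lam v k <= -1.
Proof.
move=> lamP lamD.
suff [a a0 aP] : exists2 a : 'I_N -> R, forall k, 0 <= a k &
    forall v, v \in [set: 'I_N] -> \sum_k a k * mean_toppling lam v k <= -1.
  by exists a => // v; apply: aP; rewrite inE.
have [m] := ubnP #|[set: 'I_N]|; elim: m [set: 'I_N] => // m IH H Hm.
have [->|/lamD [l lH lneg]] := eqVneq H finset.set0.
  by exists (fun _ => 0) => // v; rewrite inE.
have [|a a0 aP] := IH (H :\ l); first by rewrite -ltnS (leq_trans _ Hm) // [#|H|](cardsD1 l) lH.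
have sneg := mean_toppling_lt0 lamP lH lneg.
(* B solves B * (mean change in H) = - (1 + |mean change of the old weight|). *)
pose B := (1 + `|\sum_k a k * mean_toppling lam l k|) /
          - \sum_(k in H) mean_toppling lam l k.
have B0 : 0 <= B by rewrite divr_ge0 ?addr_ge0 // oppr_ge0 ltW.
exists (fun k => a k + B * (k \in H)%:R) => [k|v vH].
  by rewrite addr_ge0 // mulr_ge0.
under eq_bigr do rewrite mulrDl -mulrA mulr_natl mulrb.
rewrite big_split /= -mulr_sumr -big_mkcond /=.
have [->|vl] := eqVneq v l.
  rewrite /B -mulrA invrN mulNr mulVf ?lt_eqF // mulrN1 opprD.
  by have := ler_norm (\sum_k a k * mean_toppling lam l k); lra.
rewrite -[leRHS]addr0 lerD ?aP ?inE ?vl //.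
by rewrite mulr_ge0_le0 // mean_toppling_le0.
Qed.

(** Probability that the stabilization started at eta after the history past
has not stopped after n topplings. *)
Fixpoint running (R : realType) (N : nat) (lam : laws R N) (pick : policy N)
    (n : nat) (past : seq (zvec N)) (eta : zvec N) : R :=
  if stable lam eta then 0
  else if n is n'.+1 then
    topple lam (pick past eta) (running lam pick n' (rcons past eta)) eta
  else 1.

Lemma running_le1 (R : realType) (N : nat) (lam : laws R N) (pick : policy N)
    (n : nat) (past : seq (zvec N)) (eta : zvec N) :
  toppling_laws lam -> running lam pick n past eta <= 1.
Proof.
move=> lamP; elim: n past eta => [|n IH] past eta /=; case: ifP => // _.
rewrite -[leRHS](topple_cst (pick past eta) 1 eta lamP).
exact: topple_le.
Qed.

Lemma running_ge0 (R : realType) (N : nat) (lam : laws R N) (pick : policy N)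
    (n : nat) (past : seq (zvec N)) (eta : zvec N) :
  toppling_laws lam -> 0 <= running lam pick n past eta.
Proof.
move=> lamP; elim: n past eta => [|n IH] past eta /=; case: ifP => // _.
rewrite -(topple_cst (pick past eta) 0 eta lamP).
exact: topple_le.
Qed.

(** Each toppling lowers the Lyapunov function on the right by at least 1 in
mean and the left side by at most 1, and on populated configurations the right
side is nonnegative. *)
Lemma running_decay (R : realType) (N : nat) (lam : laws R N) (pick : policy N)
    (a : 'I_N -> R) (n : nat) (past : seq (zvec N)) (eta : zvec N) :
  toppling_laws lam -> legal lam pick -> (forall k, 0 <= a k) ->
  (forall v, \sum_k a k * mean_toppling lam v k <= -1) ->
  populated eta ->
  n%:R * running lam pick n past eta <= \sum_k a k * (eta k)%:~R.
Proof.
move=> lamP leg a0 aP; elim: n past eta => [|n IH] past eta epos.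
  by rewrite mul0r; apply: sumr_ge0 => k _; rewrite mulr_ge0 // ler0z ltW.
have [st|Nst] := boolP (stable lam eta).
  by rewrite /= st mulr0; apply: sumr_ge0 => k _; rewrite mulr_ge0 // ler0z ltW.
rewrite [running _ _ _ _ _]/= (negPf Nst); set v := pick past eta.
have ev := leg past eta Nst.
have T1 : topple lam v (running lam pick n (rcons past eta)) eta <= 1.
  rewrite -[leRHS](topple_cst v 1 eta lamP).
  by apply: topple_le => // nu _; apply: running_le1.
have Th : topple lam v (fun e => \sum_k a k * (e k)%:~R) eta <=
    \sum_k a k * (eta k)%:~R - 1.
  apply: le_trans (lerD (lexx _) (aP v)).
  rewrite sum_mean_toppling -(topple_cst v (\sum_k a k * (eta k)%:~R) eta lamP).
  rewrite -big_split /=; apply: ler_sum => nu _; rewrite -mulrDr -big_split /=.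
  under eq_bigr do rewrite ffunE rmorphD mulrDr.
  by [].
have TI : n%:R * topple lam v (running lam pick n (rcons past eta)) eta <=
    topple lam v (fun e => \sum_k a k * (e k)%:~R) eta.
  rewrite /topple mulr_sumr !big_seq; apply: ler_sum => nu nuv.
  rewrite mulrCA ler_wpM2l //; first by case: (lamP v).
  by apply: IH; apply: (populated_topple lamP nuv ev).
by rewrite -natr1 mulrDl mul1r; lra.
Qed.

Lemma running_cvg0 (R : realType) (N : nat) (lam : laws R N) (pick : policy N)
    (eta : zvec N) :
  toppling_laws lam -> dissipative lam -> legal lam pick -> populated eta ->
  running lam pick n [::] eta @[n --> \oo] --> (0 : R).
Proof.
move=> lamP lamD leg epos; have [a a0 aP] := exists_weights lamP lamD.
pose h := \sum_k a k * (eta k)%:~R.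
rewrite -(cvg_shiftS (fun n => running lam pick n [::] eta)).
apply: (@squeeze_cvgr _ _ _ _ (fun=> 0) (fun n => h * harmonic n)).
- apply: nearW => n; apply/andP; split; first exact: running_ge0.
  by rewrite ler_pdivlMr ?ltr0n // mulrC; exact: running_decay.
- exact: cvg_cst.
- rewrite -[X in _ --> X](mulr0 h); apply: cvgM; [exact: cvg_cst|exact: cvg_harmonic].
Qed.

(** * Harmonic functions and stabilization *)

Lemma conf_populated (R : realType) (N : nat) (lam : laws R N) (s : St lam) :
  populated (conf s).
Proof. by move=> k; rewrite ffunE. Qed.

Lemma conf_stable (R : realType) (N : nat) (lam : laws R N) (s : St lam) :
  stable lam (conf s).
Proof. by apply/stableP => v; rewrite /stable_at ffunE lez_nat ltn_ord. Qed.

Lemma conf_inj (R : realType) (N : nat) (lam : laws R N) :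
  injective (@conf R N lam).
Proof.
move=> s t /ffunP st; apply/ffunP => v; apply/val_inj.
by move: (st v); rewrite !ffunE => -[].
Qed.

Lemma stable_conf (R : realType) (N : nat) (lam : laws R N) (eta : zvec N) :
  populated eta -> stable lam eta -> exists s : St lam, conf s = eta.
Proof.
move=> epos /stableP est.
have bound v : (`|eta v|.-1 < threshold lam v)%N.
  by have := epos v; have := est v; rewrite /stable_at; case: (eta v) => // -[].
exists (finfun (fun v => Ordinal (bound v))); apply/ffunP => v; rewrite !ffunE /=.
by have := epos v; case: (eta v) => // -[].
Qed.

Lemma threshold_gt0 (R : realType) (N : nat) (lam : laws R N) (v : 'I_N) :
  toppling_laws lam -> (0 < threshold lam v)%N.
Proof.
move=> lamP; case: (lamP v) => _ tot supp.
have [nu nuv] : exists nu, nu \in finsupp (lam v).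
  apply/fset0Pn/eqP => s0; move: tot; rewrite s0 big_seq_fset0 => /esym/eqP.
  by rewrite oner_eq0.
have /and3P[nu0 _ _] := supp _ nuv.
apply: leq_trans (leq_bigmax_seq _ nuv _) => //.
by rewrite absz_gt0 lt_eqF.
Qed.

(** Stop after n topplings: the part of the mean of G carried by the runs that
have not stopped yet lies between 0 and their probability. *)
Lemma harmonic_within (R : realType) (N : nat) (lam : laws R N) (pick : policy N)
    (G : zvec N -> R) (n : nat) (past : seq (zvec N)) (eta : zvec N) :
  toppling_laws lam -> legal lam pick -> topple_harmonic lam G ->
  (forall e, 0 <= G e <= 1) -> populated eta ->
  0 <= G eta - \sum_(s : St lam) rs_within lam pick n past eta (conf s) * G (conf s)
    <= running lam pick n past eta.
Proof.
move=> lamP leg harm G01; elim: n past eta => [|n IH] past eta epos.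
all: have [st|Nst] := boolP (stable lam eta); [rewrite /= st|rewrite /= (negPf Nst)].
1,3: have [s sE] := stable_conf epos st.
1,2: rewrite (bigD1 s) //= sE eqxx mul1r big1 ?addr0 ?subrr ?lexx // => t ts.
1,2: by rewrite -sE (inj_eq (@conf_inj _ _ _)) eq_sym (negPf ts) mul0r.
- by under eq_bigr do rewrite mul0r; rewrite big1 // subr0.
rewrite -/(topple lam (pick past eta) _ eta).
set v := pick past eta; have ev := leg past eta Nst.
have -> : G eta - \sum_(s : St lam)
    (\sum_(nu <- finsupp (lam v)) lam v nu *
       rs_within lam pick n (rcons past eta) (eta + nu) (conf s)) * G (conf s) =
    topple lam v (fun e => G e - \sum_(s : St lam)
       rs_within lam pick n (rcons past eta) e (conf s) * G (conf s)) eta.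
  rewrite toppleB -(harm _ _ ev); congr (_ - _).
  by rewrite (topple_sum _ _ (fun s e => rs_within lam pick n (rcons past eta) e (conf s))).
apply/andP; split.
  rewrite -[leLHS](topple_cst v 0 eta lamP); apply: topple_le => // nu nuv.
  have /andP[lower _] := IH (rcons past eta) _ (populated_topple lamP nuv ev epos).
  exact: lower.
apply: topple_le => // nu nuv.
have /andP[_ upper] := IH (rcons past eta) _ (populated_topple lamP nuv ev epos).
exact: upper.
Qed.

Lemma harmonic_within_cvg (R : realType) (N : nat) (lam : laws R N) (pick : policy N)
    (G : zvec N -> R) (eta : zvec N) :
  toppling_laws lam -> dissipative lam -> legal lam pick -> topple_harmonic lam G ->
  (forall e, 0 <= G e <= 1) -> populated eta ->
  \sum_(s : St lam) rs_within lam pick n [::] eta (conf s) * G (conf s)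
    @[n --> \oo] --> G eta.
Proof.
move=> lamP lamD leg harm G01 epos.
have run0 := running_cvg0 lamP lamD leg epos.
apply: (@squeeze_cvgr _ _ _ _ (fun n => G eta - running lam pick n [::] eta)
  (fun=> G eta)).
- apply: nearW => n.
  have /andP[] := harmonic_within n [::] lamP leg harm G01 epos.
  by rewrite subr_ge0 => -> le_run; rewrite lerBlDr -lerBlDl le_run.
- by rewrite -[X in _ --> X]subr0; apply: cvgB => //; exact: cvg_cst.
- exact: cvg_cst.
Qed.

Lemma rs_within_cvg (R : realType) (N : nat) (lam : laws R N) (pick : policy N)
    (eta : zvec N) (s : St lam) :
  toppling_laws lam -> dissipative lam -> legal lam pick -> populated eta ->
  rs_within lam pick n [::] eta (conf s) @[n --> \oo] --> stab_law lam (conf s) eta.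
Proof.
move=> lamP lamD leg epos.
have := harmonic_within_cvg lamP lamD leg (stab_law_harmonic (conf s) lamP)
  (fun e => stab_law_bound (conf s) e lamP) epos.
under eq_cvg => n.
  under eq_bigr do rewrite stab_law_stable ?conf_stable // (inj_eq (@conf_inj _ _ _)).
  rewrite (bigD1 s) //= eqxx mulr1 big1 ?addr0; last by move=> t /negPf ->; rewrite mulr0.
  over.
by [].
Qed.

Lemma rs_probE (R : realType) (N : nat) (lam : laws R N) (pick : policy N)
    (eta : zvec N) (s : St lam) :
  toppling_laws lam -> dissipative lam -> legal lam pick -> populated eta ->
  rs_prob lam pick eta (conf s) = stab_law lam (conf s) eta.
Proof.
by move=> lamP lamD leg epos; apply: cvg_lim => //; exact: rs_within_cvg.
Qed.

(** Optional stopping for the bounded martingale given by G. *)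
Lemma harmonic_stab_law (R : realType) (N : nat) (lam : laws R N) (pick : policy N)
    (G : zvec N -> R) (eta : zvec N) :
  toppling_laws lam -> dissipative lam -> legal lam pick -> topple_harmonic lam G ->
  (forall e, 0 <= G e <= 1) -> populated eta ->
  \sum_(s : St lam) stab_law lam (conf s) eta * G (conf s) = G eta.
Proof.
move=> lamP lamD leg harm G01 epos.
have cvgG := harmonic_within_cvg lamP lamD leg harm G01 epos.
apply: (cvg_unique _ _ cvgG) => //.
apply: cvg_big => [|s _]; first exact: add_continuous.
by apply: cvgM; [exact: rs_within_cvg|exact: cvg_cst].
Qed.

(** * The kernels that add one grain *)

Definition grain_kernel (R : realType) (N : nat) (lam : laws R N) (k : 'I_N)
    (s s' : St lam) : R := stab_law lam (conf s') (conf s + grain k).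

Lemma populated_grain (N : nat) (eta : zvec N) (k : 'I_N) :
  populated eta -> populated (eta + grain k).
Proof. by move=> epos w; rewrite !ffunE ltr_wpDr. Qed.

Lemma grain_kernel_stochastic (R : realType) (N : nat) (lam : laws R N) (pick : policy N)
    (k : 'I_N) :
  toppling_laws lam -> dissipative lam -> legal lam pick ->
  stochastic (grain_kernel (lam := lam) k).
Proof.
move=> lamP lamD leg s; split=> [s'|].
  by case/andP: (stab_law_bound (conf s') (conf s + grain k) lamP).
have harm1 : topple_harmonic lam (fun=> 1) by move=> eta v _; rewrite topple_cst.
have := harmonic_stab_law lamP lamD leg harm1 _ (populated_grain k (conf_populated s)).
by under eq_bigr do rewrite mulr1; apply=> e; rewrite ler01 lexx.
Qed.

(** Abelian property for grains: stabilizing before or after the grain at l is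
added gives the same law, because adding a grain preserves instability and hence
harmonicity. *)
Lemma grain_kernel_comp (R : realType) (N : nat) (lam : laws R N) (pick : policy N)
    (k l : 'I_N) (s s' : St lam) :
  toppling_laws lam -> dissipative lam -> legal lam pick ->
  \sum_t grain_kernel k s t * grain_kernel l t s' =
  stab_law lam (conf s') (conf s + grain k + grain l).
Proof.
move=> lamP lamD leg.
apply: (harmonic_stab_law (G := fun e => stab_law lam (conf s') (e + grain l))
  lamP lamD leg) => [eta v ev|e|]; last exact/populated_grain/conf_populated.
  have ev' : ~~ stable_at lam (eta + grain l) v.
    by move: ev; rewrite /stable_at !ffunE -!ltNge => /lt_le_trans; apply; rewrite lerDl.
  rewrite (stab_law_harmonic _ lamP ev'); apply: eq_bigr => nu _.
  by rewrite addrAC.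
exact: stab_law_bound.
Qed.

Lemma grain_kernelC (R : realType) (N : nat) (lam : laws R N) (pick : policy N)
    (k l : 'I_N) (s s' : St lam) :
  toppling_laws lam -> dissipative lam -> legal lam pick ->
  \sum_t grain_kernel k s t * grain_kernel l t s' =
  \sum_t grain_kernel l s t * grain_kernel k t s'.
Proof. by move=> lamP lamD leg; rewrite !(grain_kernel_comp _ _ _ _ lamP lamD leg) addrAC. Qed.

Lemma ssmE (R : realType) (N : nat) (lam : laws R N) (pick : policy N)
    (mu : 'I_N -> R) (s s' : St lam) :
  toppling_laws lam -> dissipative lam -> legal lam pick ->
  ssm pick mu s s' = \sum_k mu k * grain_kernel k s s'.
Proof.
move=> lamP lamD leg; apply: eq_bigr => k _; congr (_ * _).
by apply: rs_probE => //; exact/populated_grain/conf_populated.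
Qed.

Lemma ssm_stochastic (R : realType) (N : nat) (lam : laws R N) (pick : policy N)
    (mu : 'I_N -> R) :
  toppling_laws lam -> dissipative lam -> legal lam pick -> is_distr mu ->
  stochastic (ssm (lam := lam) pick mu).
Proof.
move=> lamP lamD leg [mu0 mu1] s.
have Kst k := grain_kernel_stochastic k lamP lamD leg s.
split=> [s'|]; first rewrite ssmE //.
  by apply: sumr_ge0 => k _; rewrite mulr_ge0 // (Kst k).1.
under eq_bigr do rewrite ssmE //.
rewrite exchange_big /= -[RHS]mu1; apply: eq_bigr => k _.
by rewrite -mulr_sumr (Kst k).2 mulr1.
Qed.

Lemma ssm_grain_kernelC (R : realType) (N : nat) (lam : laws R N) (pick : policy N)
    (mu : 'I_N -> R) (k : 'I_N) (s s' : St lam) :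
  toppling_laws lam -> dissipative lam -> legal lam pick ->
  \sum_t ssm pick mu s t * grain_kernel k t s' =
  \sum_t grain_kernel k s t * ssm pick mu t s'.
Proof.
move=> lamP lamD leg.
under eq_bigr do rewrite ssmE // mulr_suml.
under [RHS]eq_bigr do rewrite ssmE // mulr_sumr.
rewrite exchange_big [RHS]exchange_big /=; apply: eq_bigr => l _.
under eq_bigr do rewrite -mulrA.
under [RHS]eq_bigr do rewrite mulrCA.
by rewrite -!mulr_sumr (grain_kernelC _ _ _ _ lamP lamD leg).
Qed.

Definition full (R : realType) (N : nat) (lam : laws R N) (lamP : toppling_laws lam) : St lam :=
  finfun (fun v => Ordinal (etrans (ltn_predL _) (threshold_gt0 v lamP))).

Definition room (R : realType) (N : nat) (lam : laws R N) (s : St lam) : nat :=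
  (\sum_v (threshold lam v - s v))%N.

(** While some site k of s has room, adding a grain at k yields a stable
configuration without any toppling, and reduces the room by one. *)
Lemma ssm_attracts (R : realType) (N : nat) (lam : laws R N) (pick : policy N)
    (mu : 'I_N -> R) (lamP : toppling_laws lam) :
  dissipative lam -> legal lam pick -> (forall k, 0 < mu k) ->
  attracts (ssm (lam := lam) pick mu) (@room _ _ lam) (full lamP).
Proof.
move=> lamD leg mu0 s sfull.
have [k kroom] : exists k, ((s k).+1 < threshold lam k)%N.
  apply/existsP; apply: contraNT sfull => /existsPn Nroom.
  apply/eqP/ffunP => v; apply/val_inj; rewrite ffunE /=.
  by apply/eqP; rewrite -eqSS eqn_leq prednK ?threshold_gt0 // ltn_ord leqNgt Nroom.
have sk : stable lam (conf s + grain k).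
  apply/stableP => v; rewrite /stable_at !ffunE.
  have [->|_] := eqVneq v k; first by rewrite -PoszD lez_nat addn1.
  by rewrite addr0 lez_nat ltn_ord.
have [t tE] := stable_conf (populated_grain k (conf_populated s)) sk.
have tv v : t v = (s v + (v == k))%N :> nat.
  move/ffunP: tE => /(_ v); rewrite !ffunE.
  by case: (v == k) => -[]; rewrite ?addr0 ?addn0 ?addn1 // => ->.
exists t.
  rewrite ssmE // (bigD1 k) //= ltr_pwDl //; last first.
    apply: sumr_ge0 => l _; rewrite mulr_ge0 ?(ltW (mu0 l)) //.
    exact: (grain_kernel_stochastic l lamP lamD leg s).1.
  by rewrite mulr_gt0 // /grain_kernel -tE stab_law_stable ?conf_stable // eqxx.
rewrite /room (bigD1 k) //= [X in (_ < X)%N](bigD1 k) //= -addSn leq_add //.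
  by rewrite tv eqxx addn1 subnSK // ltn_ord.
by apply: leq_sum => v vk; rewrite tv (negPf vk) addn0.
Qed.

Lemma exists_legal (R : realType) (N : nat) (lam : laws R N) :
  (0 < N)%N -> exists pick : policy N, legal lam pick.
Proof.
move=> N0; exists (fun _ eta => odflt (Ordinal N0) [pick v | ~~ stable_at lam eta v]).
move=> past eta /forallPn[v ev]; case: pickP => [//|/(_ v)]; by rewrite ev.
Qed.

Theorem proposition12 (R : realType) (N : nat) (lam : laws R N)
    (lam_laws : toppling_laws lam) (lam_dissipative : dissipative lam) :
  exists pi : {ffun St lam -> R},
    forall (pick : policy N) (mu : 'I_N -> R),
      legal lam pick -> is_distr mu ->
      stationary pick mu pi /\
      ((forall k, 0 < mu k) ->
       forall pi' : {ffun St lam -> R}, stationary pick mu pi' -> pi' = pi).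
Proof.
(* Without sites there is no distribution mu, and any function will do. *)
have [N0|N0] := posnP N.
  exists [ffun=> 0] => pick mu leg [_ mu1]; exfalso.
  have /eqP := mu1; subst N; by rewrite big_ord0 eq_sym oner_eq0.
have [pick0 leg0] := exists_legal lam N0.
pose nu := fun _ : 'I_N => (N%:R : R)^-1.
have nu0 k : 0 < nu k by rewrite invr_gt0 ltr0n.
have nud : is_distr nu.
  split=> [k|]; first exact: ltW.
  by rewrite sumr_const card_ord -[_ *+ _]mulr_natr mulVf // pnatr_eq0 -lt0n.
have Pst := ssm_stochastic lam_laws lam_dissipative leg0 nud.
have Patt := ssm_attracts (lamP := lam_laws) lam_dissipative leg0 nu0.
have [p pd pP] := invariant_distr_exists (full lam_laws) Pst.
have pK k : invariant_measure (grain_kernel k) p.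
  apply: invariant_commuting Pst Patt _ _ pd pP.
    exact: grain_kernel_stochastic lam_laws lam_dissipative leg0.
  by move=> s s'; exact: ssm_grain_kernelC.
exists (finfun p) => pick mu leg mud.
have pmu : invariant_measure (ssm pick mu) p.
  move=> s'; under eq_bigr do rewrite ssmE // mulr_sumr.
  rewrite exchange_big /= -[RHS]mul1r -mud.2 mulr_suml; apply: eq_bigr => k _.
  by rewrite -(pK k s') mulr_sumr; apply: eq_bigr => s _; rewrite mulrCA.
have pfd : is_distr (finfun p).
  split=> [s|]; first by rewrite ffunE pd.1.
  by under eq_bigr do rewrite ffunE; exact: pd.2.
have pfP : invariant_measure (ssm pick mu) (finfun p).
  by move=> s'; rewrite ffunE -[RHS]pmu; apply: eq_bigr => s _; rewrite ffunE.
split=> // mu0 q [qd qP]; apply/ffunP.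
apply: (invariant_distr_unique (ssm_stochastic lam_laws lam_dissipative leg mud)
  (ssm_attracts (lamP := lam_laws) lam_dissipative leg mu0) qd qP pfd pfP).
Qed.
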